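(* Let $\Gamma\cong\langle S\mid R\rangle$ be a group presentation with $|S|,|R|<\infty$, let $\mathcal{X}_{\langle S|R\rangle}$ be its presentation complex, and let $\rho\colon\mathbb{R}_{\ge 0}\to\mathbb{R}_{\ge 0}$ be a rate function. Then the following are equivalent (with the same function $\rho$ in both): (i) $\mathcal{X}_{\langle S|R\rangle}$ is $\rho$-cocycle stable; (ii) $\langle S\mid R\rangle$ is $\rho$-homomorphism stable.
   Context: **Rate function.** A non-decreasing $\rho\colon\mathbb{R}_{\ge0}\to\mathbb{R}_{\ge0}$ with $\rho(\varepsilon)\to0$ as $\varepsilon\to0$. **Distance of permutations.** $\mathrm{Sym}(n)$ acts on $[n]=\{1,\dots,n\}$. For $\sigma\in\mathrm{Sym}(n),\tau\in\mathrm{Sym}(N)$, $$d_h(\sigma,\tau)=1-\frac{|\{i\le\min(n,N):\sigma(i)=\tau(i)\}|}{\max(n,N)}.$$ Expectations are with respect to uniform distributions; an average over an empty set is taken to be $0$. **Homomorphism stability.** A map $f\colon S\to\mathrm{Sym}(n)$ extends uniquely to a homomorphism from the free group on $S$, also denoted $f$. For $f\colon S\to\mathrm{Sym}(n)$ and $g\colon S\to\mathrm{Sym}(N)$ put $d_h(f,g)=\mathbb{E}_{s\in S}[d_h(f(s),g(s))]$. Let $\mathrm{def}_{hom}(f)=\mathbb{E}_{r\in R}[d_h(f(r),\mathrm{Id})]$ and $\mathrm{Def}_{hom}(f)=\inf\{d_h(f,\varphi)\mid N\in\mathbb{N},\ \varphi\colon S\to\mathrm{Sym}(N),\ \varphi(r)=\mathrm{Id}\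 \forall r\in R\}$. $\langle S|R\rangle$ is $\rho$-homomorphism stable if $\mathrm{Def}_{hom}(f)\le\rho(\mathrm{def}_{hom}(f))$ for all $n$ and all $f\colon S\to\mathrm{Sym}(n)$. **Graphs and polygonal complexes.** A graph consists of a set $V$ of vertices, a set $\overrightarrow{E}$ of directed edges, maps $\iota,\tau\colon\overrightarrow{E}\to V$ (origin, terminus) and a fixed-point-free involution $e\mapsto\bar e$ of $\overrightarrow{E}$ with $\tau(\bar e)=\iota(e)$; loops and multiple edges are allowed. $E=\{[e]=\{e,\bar e\}\}$ is the set of unoriented edges. A path $e_1\cdots e_\ell$ satisfies $\tau(e_i)=\iota(e_{i+1})$ and is closed if $\iota(e_1)=\tau(e_\ell)$. The orientations of a closed path $\pi$ are its cyclic shifts and their reverses (the reverse of $e_1\cdots e_\ell$ being $\bar e_\ell\cdots\bar e_1$); $[\pi]$ denotes the set of them. A closed path is cyclically reduced if no orientation of it contains consecutive edges $e\bar e$. A polygonal complex $\mathcal{X}$ is a graph with a set $\overrightarrow{P}(\mathcal{X})$ of cyclically reduced closed paths (oriented polygons) closed under passing to orientations; $P(\mathcal{X})=\{[\pi]\}$. **Presentation complex.** $\mathcal{X}_{\langle S|R\rangle}$ has a single vertex $*$, an unoriented edge $[e(s)]=\{e(s),\overline{e(s)}\}$ for each $s\in S$, and for every $r=s_1^{\varepsilon_1}\cdots s_\ell^{\varepsilon_\ell}\in R$ (with $\varepsilon_i\in\{\pm1\}$) the polygon $\pi(r)=e(s_1)^{\varepsilon_1}\cdots e(s_\ell)^{\varepsilon_\ell}$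 together with all its orientations, where $e(s)^1=e(s)$, $e(s)^{-1}=\overline{e(s)}$. For this to be a polygonal complex with one polygon per relation, the elements of $R$ are assumed to be non-empty cyclically reduced words, no two distinct ones of which are equal up to cyclic shift and inversion. **Cocycle stability.** A $1$-cochain of $\mathcal{X}$ is a map $\alpha\colon\overrightarrow{E}(\mathcal{X})\to\mathrm{Sym}(n)$ (some $n\geq 2$) with $\alpha(\bar e)=\alpha(e)^{-1}$. For a polygon $\pi=e_1\cdots e_\ell$ put $\delta\alpha(\pi)=\alpha(e_1)\cdots\alpha(e_\ell)$; $\alpha$ is a $1$-cocycle if $\delta\alpha(\pi)=\mathrm{Id}$ for all polygons $\pi$. Put $d_h(\alpha,\beta)=\mathbb{E}_{[e]\in E(\mathcal{X})}[d_h(\alpha(e),\beta(e))]$, $\mathrm{def}_{cocyc}(\alpha)=\mathbb{E}_{[\pi]\in P(\mathcal{X})}[d_h(\delta\alpha(\pi),\mathrm{Id})]$ (independent of representatives), and $\mathrm{Def}_{cocyc}(\alpha)=\inf\{d_h(\alpha,\varphi)\mid\varphi\text{ a }1\text{-cocycle with values in some }\mathrm{Sym}(N)\}$. $\mathcal{X}$ is $\rho$-cocycle stable if $\mathrm{Def}_{cocyc}(\alpha)\le\rho(\mathrm{def}_{cocyc}(\alpha))$ for every $1$-cochain $\alpha$ (for every $n$). *)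

(* Defs.v *)
From HB Require Import structures.
From mathcomp Require Import all_boot all_order all_algebra all_fingroup finmap.
From mathcomp Require Import all_classical all_reals all_analysis.

Set Implicit Arguments.
Unset Strict Implicit.
Unset Printing Implicit Defensive.

Import Order.TTheory GRing.Theory Num.Theory.
Import numFieldNormedType.Exports.

Local Open Scope ring_scope.

Definition rate_function (K : realType) (rho : K -> K) : Prop :=
  [/\ forall x, 0 <= x -> 0 <= rho x,
      forall x y, 0 <= x -> x <= y -> rho x <= rho y
    & (rho x @[x --> 0^'+] --> (0 : K))%classic].

(* Uniform average over a duplicate-free sequence; it is 0 on the empty one. *)
Definition mean (K : realType) (T : Type) (s : seq T) (F : T -> K) : K :=
  (\sum_(x <- s) F x) / (size s)%:R.

(* The value of F at a chosen representative of the class c. *)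
Definition at_repr (K : realType) (T : choiceType) (F : T -> K)
    (c : {fset T}) : K :=
  if enum_fset c is x :: _ then F x else 0.

Lemma at_reprE (K : realType) (T : choiceType) (F : T -> K) (c : {fset T}) x :
  x \in c -> (forall y, y \in c -> F y = F x) -> at_repr F c = F x.
Proof.
rewrite /at_repr => xc Fc.
have := xc; rewrite -[x \in c]/(x \in enum_fset c).
case E: (enum_fset c) => [|y s] // _.
by apply: Fc; rewrite -[y \in c]/(y \in enum_fset c) E mem_head.
Qed.

(* [n] is 'I_n, i.e. {0, ..., n-1}. *)
Definition agreement n N (sigma : 'S_n) (tau : 'S_N) : nat :=
  #|[pred i : 'I_(minn n N) | (sigma (widen_ord (geq_minl n N) i) : nat)
                           == (tau (widen_ord (geq_minr n N) i) : nat)]|.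

Definition dh (K : realType) n N (sigma : 'S_n) (tau : 'S_N) : K :=
  1 - (agreement sigma tau)%:R / (maxn n N)%:R.

(* The product a(x_1) ... a(x_l) for the composition (st)(i) = s(t(i)); the
   group law on 'S_n is composition in the opposite order, hence [rev]. *)
Definition perm_prod (T : Type) n (a : T -> 'S_n) (w : seq T) : 'S_n :=
  (\prod_(x <- rev w) a x)%g.

Lemma perm_prod_cons (T : Type) n (a : T -> 'S_n) x w i :
  perm_prod a (x :: w) i = a x (perm_prod a w i).
Proof. by rewrite /perm_prod rev_cons -cats1 big_cat big_seq1 permM. Qed.

Lemma perm_prod_cat (T : Type) n (a : T -> 'S_n) u v i :
  perm_prod a (u ++ v) i = perm_prod a u (perm_prod a v i).
Proof. by rewrite /perm_prod rev_cat big_cat permM. Qed.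

(* Sequences over an alphabet with an involution [bar]: used both for words in
   S and S^-1 and for paths of directed edges. *)

Definition reversal (T : Type) (bar : T -> T) (p : seq T) : seq T :=
  rev (map bar p).

Definition shifts (T : Type) (p : seq T) : seq (seq T) :=
  [seq rot i p | i <- iota 0 (size p)].

Definition orientations (T : choiceType) (bar : T -> T) (p : seq T) :
    {fset seq T} :=
  [fset q in shifts p ++ map (reversal bar) (shifts p)]%fset.

Definition cyclically_reduced (T : choiceType) (bar : T -> T) (p : seq T) :=
  forall q x, q \in orientations bar p -> ~~ infix [:: x; bar x] q.

Lemma orientationsP (T : choiceType) (bar : T -> T) (p q : seq T) :
  p != [::] ->
  reflect (exists i, q = rot i p \/ q = reversal bar (rot i p))
          (q \in orientations bar p).
Proof.
move=> p0; have sp : (0 < size p)%N by rewrite lt0n size_eq0.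
have shiftE i : rot i p \in shifts p.
  case: (ltnP i (size p)) => hi; first by apply: map_f; rewrite mem_iota.
  rewrite rot_oversize // -{1}(rot0 p); apply: map_f.
  by rewrite mem_iota.
have -> : (q \in orientations bar p) =
    (q \in shifts p ++ map (reversal bar) (shifts p)) by rewrite in_fset.
rewrite mem_cat; apply: (iffP orP).
- case=> [/mapP[i _ ->]|/mapP[_ /mapP[i _ ->] ->]]; exists i; by [left|right].
- by case=> i [->|->]; [left|right; apply: map_f].
Qed.

Lemma orientations_refl (T : choiceType) (bar : T -> T) (p : seq T) :
  p != [::] -> p \in orientations bar p.
Proof. by move=> p0; apply/orientationsP => //; exists 0%N; left; rewrite rot0. Qed.

Lemma size_orientation (T : choiceType) (bar : T -> T) (p q : seq T) :
  p != [::] -> q \in orientations bar p -> size q = size p.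
Proof.
move=> p0 /(orientationsP _ _ p0)[i [->|->]];
  by rewrite /reversal ?size_rev ?size_map size_rot.
Qed.

Lemma orientation_neq0 (T : choiceType) (bar : T -> T) (p q : seq T) :
  p != [::] -> q \in orientations bar p -> q != [::].
Proof. by move=> p0 /(size_orientation p0) s; rewrite -size_eq0 s size_eq0. Qed.

Lemma orientations_trans (T : choiceType) (bar : T -> T) (p q u : seq T) :
  involutive bar -> p != [::] ->
  q \in orientations bar p -> u \in orientations bar q ->
  u \in orientations bar p.
Proof.
move=> barK p0 qp uq; have q0 := orientation_neq0 p0 qp.
have rotrev j v : exists k, rot j (reversal bar v) = reversal bar (rot k v).
  exists (size v - j)%N; rewrite /reversal map_rot.
  by rewrite -rev_rotr /rotr size_map.
have revK' v : reversal bar (reversal bar v) = v.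
  by rewrite /reversal map_rev revK mapK.
apply/orientationsP => //.
move: qp uq => /(orientationsP _ _ p0)[i qE] /(orientationsP _ _ q0)[j].
case: qE => ->; case=> ->.
- by exists (rot_add p i j); left; rewrite rot_rot_add.
- by exists (rot_add p i j); right; rewrite rot_rot_add.
- case: (rotrev j (rot i p)) => k ->.
  by exists (rot_add p i k); right; rewrite rot_rot_add.
- case: (rotrev j (rot i p)) => k ->; rewrite revK'.
  by exists (rot_add p i k); left; rewrite rot_rot_add.
Qed.

(* Only finite complexes are needed: the averages below are over finite sets. *)
Record polygonal_complex := PolygonalComplex {
  vertex : eqType;
  dedge : finType;
  origin : dedge -> vertex;
  terminus : dedge -> vertex;
  ebar : dedge -> dedge;
  opolygons : {fset seq dedge};
  _ : involutive ebar;
  _ : forall e, ebar e != e;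
  _ : forall e, terminus (ebar e) = origin e;
  _ : forall p, p \in opolygons ->
        [/\ p != [::],
            path.cycle (fun e e' => terminus e == origin e') p
          & cyclically_reduced ebar p];
  _ : forall p q, p \in opolygons -> q \in orientations ebar p ->
        q \in opolygons
}.

Section CocycleStability.
Variables (K : realType) (X : polygonal_complex).

Definition edges : {fset {fset dedge X}} :=
  [fset [fset e; ebar e]%fset | e : dedge X]%fset.

Definition polygons : {fset {fset seq (dedge X)}} :=
  [fset orientations (@ebar X) p | p in opolygons X]%fset.

Definition cochain n (alpha : dedge X -> 'S_n) : Prop :=
  (2 <= n)%N /\ forall e, alpha (ebar e) = (alpha e)^-1%g.

Definition cocycle n (alpha : dedge X -> 'S_n) : Prop :=
  cochain alpha /\
  forall p, p \in opolygons X -> perm_prod alpha p = 1%g.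

Definition cochain_dist n N (alpha : dedge X -> 'S_n)
    (beta : dedge X -> 'S_N) : K :=
  mean edges (at_repr (fun e => dh K (alpha e) (beta e))).

Definition def_cocyc n (alpha : dedge X -> 'S_n) : K :=
  mean polygons (at_repr (fun p => dh K (perm_prod alpha p) (1%g : 'S_n))).

Definition Def_cocyc n (alpha : dedge X -> 'S_n) : K :=
  inf [set d | exists N (phi : dedge X -> 'S_N),
                 cocycle phi /\ d = cochain_dist alpha phi]%classic.

Definition cocycle_stable (rho : K -> K) : Prop :=
  forall n (alpha : dedge X -> 'S_n), cochain alpha ->
    Def_cocyc alpha <= rho (def_cocyc alpha).

End CocycleStability.

(* The letter (s, true) is s and (s, false) is s^-1. *)
Definition letter (S : finType) : finType := (S * bool)%type.
Definition word (S : finType) := seq (letter S).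

Definition letter_inv (S : finType) (x : letter S) : letter S := (x.1, ~~ x.2).

Definition relators (S : finType) (R : {fset word S}) : Prop :=
  [/\ forall r, r \in R -> r != [::],
      forall r, r \in R -> cyclically_reduced (@letter_inv S) r
    & forall r r', r \in R -> r' \in R ->
        r' \in orientations (@letter_inv S) r -> r' = r].

Section HomomorphismStability.
Variables (K : realType) (S : finType) (R : {fset word S}).

(* The value at a word of the homomorphism from the free group extending f. *)
Definition hom_ext n (f : S -> 'S_n) (w : word S) : 'S_n :=
  perm_prod (fun x : letter S => if x.2 then f x.1 else (f x.1)^-1%g) w.

Definition hom_dist n N (f : S -> 'S_n) (g : S -> 'S_N) : K :=
  mean (enum S) (fun s => dh K (f s) (g s)).

Definition def_hom n (f : S -> 'S_n) : K :=
  mean R (fun r => dh K (hom_ext f r) (1%g : 'S_n)).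

Definition Def_hom n (f : S -> 'S_n) : K :=
  inf [set d | exists N (phi : S -> 'S_N),
                 [/\ (0 < N)%N, forall r, r \in R -> hom_ext phi r = 1%g
                   & d = hom_dist f phi]]%classic.

Definition homomorphism_stable (rho : K -> K) : Prop :=
  forall n (f : S -> 'S_n), (0 < n)%N -> Def_hom f <= rho (def_hom f).

End HomomorphismStability.

Section PresentationComplex.
Variables (S : finType) (R : {fset word S}) (hR : relators R).

(* The directed edges e(s) and its reverse are the letters (s, true) and
   (s, false), so that the path pi(r) is the word r itself. *)
Definition pres_opolygons : {fset seq (letter S)} :=
  (\bigcup_(r <- R) orientations (@letter_inv S) r)%fset.

Lemma letter_invK : involutive (@letter_inv S).
Proof. by case=> s b; rewrite /letter_inv /= negbK. Qed.

Lemma letter_inv_neq (x : letter S) : letter_inv x != x.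
Proof. by case: x => s b; rewrite /letter_inv xpair_eqE /= eqxx; case: b. Qed.

Lemma pres_opolygonsP p :
  reflect (exists2 r, r \in R & p \in orientations (@letter_inv S) r)
          (p \in pres_opolygons).
Proof.
rewrite /pres_opolygons.
apply: (iffP (bigfcupP _ _ _ _)) => [[r /andP[rR _] pr]|[r rR pr]].
  by exists r.
by exists r => //; rewrite rR.
Qed.

Lemma pres_opolygon_path p : p \in pres_opolygons ->
  [/\ p != [::], path.cycle (fun _ _ : letter S => tt == tt) p
    & cyclically_reduced (@letter_inv S) p].
Proof.
case: hR => R0 Rred _ /pres_opolygonsP[r rR pr]; have r0 := R0 _ rR.
split; first exact: orientation_neq0 pr.
- by case: p {pr} => //= x p; move: (rcons p x) => s; elim: s x => //= y s IH _.
- move=> q x qp; apply: (Rred _ rR).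
  exact: orientations_trans letter_invK r0 pr qp.
Qed.

Lemma pres_opolygon_closed p q : p \in pres_opolygons ->
  q \in orientations (@letter_inv S) p -> q \in pres_opolygons.
Proof.
case: hR => R0 _ _ /pres_opolygonsP[r rR pr] qp; apply/pres_opolygonsP.
exists r => //; exact: orientations_trans letter_invK (R0 _ rR) pr qp.
Qed.

Definition presentation_complex : polygonal_complex :=
  @PolygonalComplex unit (letter S) (fun=> tt) (fun=> tt) (@letter_inv S)
    pres_opolygons letter_invK letter_inv_neq (fun=> erefl)
    pres_opolygon_path pres_opolygon_closed.

End PresentationComplex.

(* Main.v *)
Require Import Defs.
From mathcomp Require Import all_boot all_order all_algebra finmap reals.
From mathcomp Require Import all_fingroup all_classical.

(** The complex of a presentation has one vertex, so a cochain alpha is the same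
    thing as a map f on the generators: f (s) is the value of alpha on the edge
    e(s), and alpha is recovered by inverting on the reversed edges. What has to
    be seen is that this bijection preserves all three quantities in the two
    notions of stability, so that the same rate function serves for both.

    Each average on the complex runs over classes, and reduces to an average on
    the presentation because a class has a preferred representative and the
    averaged function is constant on it. For edges, s indexes the class of e(s),
    and the Hamming distance is unchanged when both arguments are inverted
    ([dhV]), which gives [cochain_distE]. For polygons, r indexes the class of
    pi(r), faithfully because distinct relators are never orientations of each
    other. Rotating a path conjugates its product and reversing it inverts its
    product; neither changes the distance to the identity, which gives
    [def_cocycE].

    The infima require one more argument, since cocycles take values in Sym(N)
    with N >= 2 while homomorphisms may take values in Sym(1). The only map to
    Sym(1) is trivial, and replacing it by the trivial map to Sym(2) does not
    increase the distance to a map with values in Sym(n), n >= 2: the number of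
    agreements can only grow and the denominator stays n. Hence [Def_cocycE].
    Finally a map f into Sym(1), which corresponds to no cochain, is itself a
    homomorphism, so its stability inequality says only that rho is
    non-negative. *)

Set Implicit Arguments.
Unset Strict Implicit.
Unset Printing Implicit Defensive.

Import Order.TTheory GRing.Theory Num.Theory.

Local Open Scope ring_scope.

(** * The Hamming distance *)

(** Counting pairs with equal entries, instead of indices below the minimum of
    the two degrees, lets a pair of permutations act on the counted set; the
    symmetries of the distance then become bijections. *)
Lemma agreement_pairs n N (sigma : 'S_n) (tau : 'S_N) :
  agreement sigma tau =
  #|[set x : 'I_n * 'I_N | (x.1 == x.2 :> nat)
                        && (sigma x.1 == tau x.2 :> nat)]|.
Proof.
pose f (i : 'I_(minn n N)) := (widen_ord (geq_minl n N) i,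
                               widen_ord (geq_minr n N) i).
have f_inj : injective f by move=> i j [/ord_inj].
rewrite /agreement -(card_imset _ f_inj); apply: eq_card => -[i j].
rewrite inE /=; apply/imsetP/andP => [[k + [-> ->]]|[/eqP ij agr]].
  by rewrite inE eqxx.
have hi : (i < minn n N)%N by rewrite leq_min ltn_ord ij ltn_ord.
have fi : (i, j) = f (Ordinal hi) by congr (_, _); exact: ord_inj.
exists (Ordinal hi) => //.
rewrite inE -[widen_ord (geq_minl _ _) _]/(f _).1.
by rewrite -[widen_ord (geq_minr _ _) _]/(f _).2 -fi.
Qed.

(** An agreement of sigma and tau at i is an agreement of their inverses at the
    common value sigma i = tau i. *)
Lemma agreementV n N (sigma : 'S_n) (tau : 'S_N) :
  agreement sigma^-1%g tau^-1%g = agreement sigma tau.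
Proof.
pose f (x : 'I_n * 'I_N) := (sigma x.1, tau x.2).
have f_inj : injective f by move=> [i j] [k l] [/perm_inj-> /perm_inj->].
rewrite !agreement_pairs -[RHS](card_imset _ f_inj); apply: eq_card => -[i j].
rewrite inE /=; apply/andP/imsetP => [[ij agr]|[[k l] + [-> ->]]].
  by exists (sigma^-1 i, tau^-1 j)%g; rewrite ?inE /f /= ?permKV ?agr.
by rewrite inE /= !permK => /andP[-> ->].
Qed.

Lemma agreement_conj n (sigma tau c : 'S_n) :
  agreement (sigma ^ c)%g (tau ^ c)%g = agreement sigma tau.
Proof.
pose f (x : 'I_n * 'I_n) := (c x.1, c x.2).
have f_inj : injective f by move=> [i j] [k l] [/perm_inj-> /perm_inj->].
rewrite !agreement_pairs -[LHS](card_preimset _ f_inj).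
apply: eq_card => -[i j]; rewrite !inE /= !permJ.
by rewrite !(inj_eq val_inj) !(inj_eq perm_inj).
Qed.

Section Distance.
Variable K : realType.

Lemma dh_ge0 n N (sigma : 'S_n) (tau : 'S_N) : 0 <= dh K sigma tau.
Proof.
have le_agr : (agreement sigma tau <= maxn n N)%N.
  rewrite (leq_trans (max_card _)) // card_ord.
  by rewrite (leq_trans (geq_minl _ _)) // leq_maxl.
rewrite subr_ge0; case: (posnP (maxn n N)) => [->|max_gt0].
  by rewrite invr0 mulr0.
by rewrite ler_pdivrMr ?ltr0n // mul1r ler_nat.
Qed.

Lemma dhV n N (sigma : 'S_n) (tau : 'S_N) :
  dh K sigma^-1%g tau^-1%g = dh K sigma tau.
Proof. by rewrite /dh agreementV. Qed.

Lemma dhxx n (sigma : 'S_n) : (0 < n)%N -> dh K sigma sigma = 0.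
Proof.
move=> n0; rewrite /dh maxnn.
have -> : agreement sigma sigma = n.
  rewrite -[RHS]minnn -[RHS]card_ord; apply: eq_card => i.
  rewrite inE /= (_ : widen_ord _ i = widen_ord (geq_minr n n) i) ?eqxx //.
  exact: ord_inj.
by rewrite divff ?subrr // pnatr_eq0 -lt0n.
Qed.

(** Products in the two orders are conjugate. *)
Lemma dh_1_mulC n (sigma tau : 'S_n) :
  dh K (sigma * tau)%g (1%g : 'S_n) = dh K (tau * sigma)%g (1%g : 'S_n).
Proof.
rewrite /dh -(agreement_conj (sigma * tau) _ sigma) conj1g conjgE.
by rewrite -mulgA mulKg.
Qed.

(** Enlarging the second degree up to n adds fixed points that may be matched,
    while the normalisation max(n, N) = n does not change. *)
Lemma dh_widen1 n N M (sigma : 'S_n) : (N <= M <= n)%N ->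
  dh K sigma (1%g : 'S_M) <= dh K sigma (1%g : 'S_N).
Proof.
move=> /andP[NM Mn]; have Nn := leq_trans NM Mn.
rewrite /dh (maxn_idPl Mn) (maxn_idPl Nn) lerD2l lerN2.
rewrite ler_wpM2r ?invr_ge0 // ler_nat !agreement_pairs.
pose f (x : 'I_n * 'I_N) := (x.1, widen_ord NM x.2).
have f_inj : injective f.
  by move=> [i j] [k l] [-> jl]; congr (_, _); exact: ord_inj.
rewrite -(card_imset _ f_inj); apply/subset_leq_card/fintype.subsetP => x.
by move=> /imsetP[[i j] + ->]; rewrite !inE /= !perm1.
Qed.

End Distance.

(** * Products along orientations of a path *)

Lemma orientations_sym (T : choiceType) (bar : T -> T) (p q : seq T) :
  involutive bar -> p != [::] ->
  q \in orientations bar p -> p \in orientations bar q.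
Proof.
move=> barK p0 qp; have q0 := orientation_neq0 p0 qp.
have p_rot i : p \in orientations bar (rot i p).
  have rot_neq0 : rot i p != [::] by rewrite -size_eq0 size_rot size_eq0.
  apply/orientationsP => //; exists (size (rot i p) - i)%N; left.
  by rewrite -[LHS](rotK i).
move: (qp) => /(orientationsP _ _ p0)[i [->|qE]]; first exact: p_rot.
apply: (orientations_trans barK q0 _ (p_rot i)).
apply/orientationsP => //; exists 0%N; right.
by rewrite rot0 qE /reversal map_rev revK mapK.
Qed.

Section PathProduct.
Variables (T : choiceType) (bar : T -> T) (n : nat) (a : T -> 'S_n).
Hypothesis a_bar : forall x, a (bar x) = (a x)^-1%g.

Lemma perm_prod_catE p q :
  perm_prod a (p ++ q) = (perm_prod a q * perm_prod a p)%g.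
Proof. by apply/permP => i; rewrite perm_prod_cat permM. Qed.

Lemma perm_prod_reversal p :
  perm_prod a (reversal bar p) = (perm_prod a p)^-1%g.
Proof.
elim: p => [|x p IHp].
  by rewrite /reversal /perm_prod /= !big_nil invg1.
rewrite -cat1s [in RHS]perm_prod_catE invMg -IHp /reversal map_cat rev_cat.
by rewrite perm_prod_catE {1 3}/perm_prod /= !big_seq1 a_bar.
Qed.

(** This is what makes the defect of a polygon independent of the oriented
    representative. *)
Lemma perm_prod_orientation (K : realType) p q :
  p != [::] -> q \in orientations bar p ->
  dh K (perm_prod a q) (1%g : 'S_n) = dh K (perm_prod a p) (1%g : 'S_n).
Proof.
have dh_rot i : dh K (perm_prod a (rot i p)) (1%g : 'S_n)
              = dh K (perm_prod a p) (1%g : 'S_n).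
  by rewrite -[p in RHS](cat_take_drop i) !perm_prod_catE dh_1_mulC.
move=> p0 /(orientationsP _ _ p0)[i [->|->]] //.
by rewrite perm_prod_reversal -{1}[1%g]invg1 dhV dh_rot.
Qed.

Lemma perm_prod_orientation1 p q : p != [::] -> q \in orientations bar p ->
  perm_prod a p = 1%g -> perm_prod a q = 1%g.
Proof.
move=> p0 /(orientationsP _ _ p0)[i] + p1.
have rot1 : perm_prod a (rot i p) = 1%g.
  move: p1; rewrite -[p in LHS](cat_take_drop i) !perm_prod_catE => /eqP.
  by rewrite mulg_eq1 => /eqP ->; rewrite mulgV.
by case=> ->; rewrite ?perm_prod_reversal rot1 ?invg1.
Qed.

End PathProduct.

(** * Averages and distances to homomorphisms *)

Section Mean.
Variable K : realType.

(** The sequences are compared only up to order, because the enumeration of a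
    finite set of classes bears no relation to that of its index set. *)
Lemma mean_reindex (I T : eqType) (r : seq I) (s : seq T) (h : I -> T)
    (F : T -> K) :
  uniq r -> uniq s -> {in r &, injective h} -> s =i map h r ->
  mean s F = mean r (F \o h).
Proof.
move=> r_uniq s_uniq h_inj s_h.
have s_perm : perm_eq s (map h r) by rewrite uniq_perm ?map_inj_in_uniq.
by rewrite /mean (perm_big _ s_perm) big_map (perm_size s_perm) size_map.
Qed.

Lemma eq_in_mean (I : eqType) (r : seq I) (F G : I -> K) :
  {in r, F =1 G} -> mean r F = mean r G.
Proof. by move=> FG; rewrite /mean (eq_big_seq _ FG). Qed.

Lemma ler_mean (I : eqType) (r : seq I) (F G : I -> K) :
  (forall i, F i <= G i) -> mean r F <= mean r G.
Proof. by move=> FG; rewrite ler_wpM2r ?invr_ge0 ?ler0n// ler_sum. Qed.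

Lemma mean_ge0 (I : eqType) (r : seq I) (F : I -> K) :
  (forall i, 0 <= F i) -> 0 <= mean r F.
Proof. by move=> F0; rewrite divr_ge0 ?sumr_ge0. Qed.

Lemma mean0 (I : eqType) (r : seq I) : mean r (fun=> 0 : K) = 0.
Proof. by rewrite /mean big1_eq mul0r. Qed.

End Mean.

Section HomomorphismDistance.
Variables (K : realType) (S : finType) (R : {fset word S}).

Lemma hom_dist_ge0 n N (f : S -> 'S_n) (g : S -> 'S_N) : 0 <= hom_dist K f g.
Proof. by apply: mean_ge0 => s; exact: dh_ge0. Qed.

Lemma hom_ext1 n (w : word S) : hom_ext (fun=> 1%g : 'S_n) w = 1%g.
Proof.
by rewrite /hom_ext /perm_prod big1 // => -[s []] _ /=; rewrite ?invg1.
Qed.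

Lemma Def_hom_eq0 n (f : S -> 'S_n) : (0 < n)%N ->
  (forall r, r \in R -> hom_ext f r = 1%g) -> Def_hom K R f <= 0.
Proof.
move=> n0 f_hom; apply: ge_inf.
  by exists 0 => _ [N [phi [_ _ ->]]]; exact: hom_dist_ge0.
exists n, f; split=> //; rewrite /hom_dist -(mean0 K (enum S)).
by apply: eq_in_mean => s _; rewrite dhxx.
Qed.

End HomomorphismDistance.

(** * Cochains of the presentation complex *)

Section PresentationComplex.
Variables (K : realType) (S : finType) (R : {fset word S}) (hR : relators R).

Let X := presentation_complex hR.

Definition generator_values n (alpha : letter S -> 'S_n) (s : S) : 'S_n :=
  alpha (s, true).

Definition cochain_of n (f : S -> 'S_n) (x : letter S) : 'S_n :=
  if x.2 then f x.1 else (f x.1)^-1%g.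

Lemma cochain_ofV n (f : S -> 'S_n) x :
  cochain_of f (letter_inv x) = (cochain_of f x)^-1%g.
Proof. by case: x => s []; rewrite /cochain_of /= ?invgK. Qed.

Lemma hom_ext_generator_values n (alpha : dedge X -> 'S_n) : cochain alpha ->
  hom_ext (generator_values alpha) =1 perm_prod alpha.
Proof.
move=> [_ alphaV] w; rewrite /hom_ext /perm_prod.
apply: eq_bigr => -[s []] _ //.
by rewrite /generator_values -alphaV.
Qed.

(** The class {e, e'} of an edge and its reverse is indexed by the generator s
    with e = e(s); inverting both values leaves their distance unchanged. *)
Lemma cochain_distE n N (alpha : dedge X -> 'S_n) (beta : dedge X -> 'S_N) :
  cochain alpha -> cochain beta ->
  cochain_dist K alpha beta =
  hom_dist K (generator_values alpha) (generator_values beta).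
Proof.
move=> [_ alphaV] [_ betaV].
pose edge_of (s : S) : {fset dedge X} :=
  [fset ((s, true) : dedge X); @ebar X (s, true)]%fset.
rewrite /cochain_dist (@mean_reindex _ _ _ (enum S) _ edge_of) ?enum_uniq //.
- apply: eq_in_mean => s _ /=.
  rewrite (at_reprE (x := (s, true) : dedge X)) ?in_fset2 ?eqxx //.
  move=> y; rewrite in_fset2 => /orP[/eqP->//|/eqP->].
  by rewrite alphaV betaV dhV.
- exact: fset_uniq.
- move=> s t _ _ /fsetP/(_ (s, true)).
  by rewrite !in_fset2 eqxx /= xpair_eqE andbT => /esym/orP[/eqP|/eqP[]].
- move=> c; apply/imfsetP/mapP => /= [[[s b] _ ->]|[s _ ->]].
    exists s; first by rewrite mem_enum.
    by case: b => //; rewrite fsetUC.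
  by exists (s, true).
Qed.

(** Sending r to the class of pi(r) is a bijection from relators to polygons; its
    injectivity is the assumption that distinct relators are never equal up to
    cyclic shift and inversion. *)
Lemma def_cocycE n (alpha : dedge X -> 'S_n) : cochain alpha ->
  def_cocyc K alpha = def_hom K R (generator_values alpha).
Proof.
move=> alphaP; have [_ alphaV] := alphaP.
have [R0 _ R_inj] := hR.
rewrite /def_cocyc (@mean_reindex _ _ _ R _ (orientations (@ebar X))).
- apply: eq_in_mean => r rR /=; have r0 := R0 _ rR.
  rewrite (at_reprE (x := r)) ?orientations_refl // => [|p pr].
    by rewrite hom_ext_generator_values.
  exact: (perm_prod_orientation alphaV).
- exact: fset_uniq.
- exact: fset_uniq.
- move=> r r' rR r'R eq_or; apply: R_inj => //.
  by rewrite -[X in _ \in X]eq_or orientations_refl // R0.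
- move=> c; apply/imfsetP/mapP => /=.
    move=> [p /pres_opolygonsP[r rR pr] ->].
    exists r => //; apply/fsetP => q; have r0 := R0 _ rR.
    have p0 := orientation_neq0 r0 pr.
    apply/idP/idP; first exact: (orientations_trans (@letter_invK S) r0 pr).
    have rp := orientations_sym (@letter_invK S) r0 pr.
    exact: (orientations_trans (@letter_invK S) p0 rp).
  move=> [r rR ->]; exists r => //; apply/pres_opolygonsP; exists r => //.
  by apply: orientations_refl; exact: R0.
Qed.

Lemma cocycleP n (phi : dedge X -> 'S_n) : cochain phi ->
  cocycle phi <-> (forall r, r \in R -> hom_ext (generator_values phi) r = 1%g).
Proof.
move=> phiP; have [R0 _ _] := hR; have [_ phiV] := phiP.
split=> [[_ phi1] r rR|phi1].
  rewrite hom_ext_generator_values //; apply: phi1; apply/pres_opolygonsP.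
  by exists r => //; apply: orientations_refl; exact: R0.
split=> // p /pres_opolygonsP[r rR pr].
apply: (perm_prod_orientation1 phiV _ pr); first exact: R0.
by rewrite -hom_ext_generator_values // phi1.
Qed.

Lemma cochain_of_cochain n (f : S -> 'S_n) : (2 <= n)%N ->
  cochain (X := X) (cochain_of f).
Proof. by move=> n2; split=> // x; exact: cochain_ofV. Qed.

Lemma hom_dist_trivial n N M (f : S -> 'S_n) : (N <= M <= n)%N ->
  hom_dist K f (fun=> 1%g : 'S_M) <= hom_dist K f (fun=> 1%g : 'S_N).
Proof. by move=> NMn; apply: ler_mean => s; exact: dh_widen1. Qed.

(** The two infima are over nested sets, homomorphisms to Sym(1) being the only
    ones without a corresponding cocycle; the trivial homomorphism to Sym(2) is
    at least as close as they are. *)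
Lemma Def_cocycE n (alpha : dedge X -> 'S_n) : cochain alpha ->
  Def_cocyc K alpha = Def_hom K R (generator_values alpha).
Proof.
move=> alphaP; have [n2 _] := alphaP; set f := generator_values alpha.
have triv_cocycle : cocycle (X := X) (cochain_of (fun=> 1%g : 'S_2)).
  by apply/cocycleP; [exact: cochain_of_cochain|move=> r _; exact: hom_ext1].
apply/eqP; rewrite eq_le; apply/andP; split.
  apply: lb_le_inf.
    exists (hom_dist K f (fun=> 1%g : 'S_1)), 1%N, (fun=> 1%g).
    by split=> // r _; exact: hom_ext1.
  move=> _ [N [phi [N0 phi1 ->]]].
  have Def_le M (psi : S -> 'S_M) : (2 <= M)%N ->
      (forall r, r \in R -> hom_ext psi r = 1%g) ->
      Def_cocyc K alpha <= hom_dist K f psi.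
    move=> M2 psi1; apply: ge_inf.
      exists 0 => _ [N' [beta [[betaP _] ->]]].
      by rewrite cochain_distE //; exact: hom_dist_ge0.
    have psiP := cochain_of_cochain psi M2.
    exists M, (cochain_of psi); split; first by apply/cocycleP.
    by rewrite cochain_distE.
  have [N2|] := leqP 2 N; first exact: Def_le.
  rewrite ltnS leq_eqVlt ltnS leqNgt N0 orbF => /eqP N1; subst N.
  have -> : phi = fun=> 1%g.
    by apply/funext => s; apply/permP => i; rewrite !ord1.
  apply: le_trans (hom_dist_trivial (M := 2) _ _); last by rewrite n2.
  by apply: Def_le => // r _; exact: hom_ext1.
apply: lb_le_inf; first by eexists; exists 2, (cochain_of (fun=> 1%g)).
move=> _ [N [phi [phi_cocycle ->]]]; have [phiP _] := phi_cocycle.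
apply: ge_inf; first by exists 0 => _ [M [psi [_ _ ->]]]; exact: hom_dist_ge0.
exists N, (generator_values phi); split; last exact: cochain_distE.
  by case: phiP => N2 _; exact: ltnW.
exact/cocycleP.
Qed.

End PresentationComplex.

Theorem theorem1p2 (K : realType) (S : finType) (R : {fset word S})
    (hR : relators R) (rho : K -> K) (hrho : rate_function rho) :
  cocycle_stable (presentation_complex hR) rho <-> homomorphism_stable R rho.
Proof.
split=> [cocyc_stable n f n0|hom_stable n alpha alphaP].
  have [n2|] := leqP 2 n.
    have alphaP := cochain_of_cochain hR f n2.
    by have := cocyc_stable _ _ alphaP; rewrite Def_cocycE // def_cocycE.
  (* Only degree 1 remains, where f is a homomorphism and both sides compare
     with 0. *)
  case: n f n0 => [|[|//]] f // n0 _.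
  have f1 : f = fun=> 1%g by apply/funext => s; apply/permP => i; rewrite !ord1.
  apply: (@le_trans _ _ 0).
    by apply: Def_hom_eq0 => // r _; rewrite f1 hom_ext1.
  have [rho_ge0 _ _] := hrho; apply: rho_ge0.
  by apply: mean_ge0 => r; exact: dh_ge0.
have [n2 _] := alphaP.
by rewrite Def_cocycE // def_cocycE //; apply: hom_stable; exact: ltnW.
Qed.
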